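(* Let $n\ge 1$ be a fixed integer. For an integer $H\ge 1$ let $\mathcal{M}_n(\mathbb{Z};H)$ be the set of $n\times n$ matrices $A=(a_{ij})_{i,j=1}^n$ with integer entries satisfying $|a_{ij}|\le H$ for all $i,j$, and define \[ \Phi_n(H)=\sum_{\substack{A\in\mathcal{M}_n(\mathbb{Z};H)\\ \det A\ne 0}}\frac{\varphi(|\det A|)}{|\det A|}, \] where $\varphi$ is the Euler totient function. Then \[ \Phi_n(H)=2^{n^2}\sigma_n H^{n^2}+O\left(H^{n^2-\vartheta_n+o(1)}\right) \] as $H\to\infty$, where \[ \sigma_n=\prod_{p\ \text{prime}}\left(1-\frac1p\right)\left(1+\frac1p\prod_{j=2}^{n}\left(1-p^{-j}\right)\right),\qquad \vartheta_n=1-\frac{1}{n^3+1}. \]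
   Context: Implied constants depend only on $n$. The notation $O(H^{a+o(1)})$ means: for every fixed $\varepsilon>0$ the quantity is $O(H^{a+\varepsilon})$ for all sufficiently large $H$ (with the implied constant allowed to depend on $n$ and $\varepsilon$). *)

(* Defs.v *)
From HB Require Import structures.
From mathcomp Require Import all_boot all_order all_algebra.
From mathcomp Require Import all_classical all_reals all_analysis.
Set Implicit Arguments. Unset Strict Implicit. Unset Printing Implicit Defensive.
Import Order.TTheory GRing.Theory Num.Theory.
Import numFieldNormedType.Exports.
Local Open Scope ring_scope.
Local Open Scope classical_set_scope.

(* The box M_n(Z;H) is parametrised bijectively by matrices B with entries
   k : 'I_(2H+1), via a_ij = k - H (so a_ij ranges over [-H, H]). *)
Definition box_to_int (n H : nat) (B : 'M['I_(2 * H).+1]_n) : 'M[int]_n :=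
  \matrix_(i, j) ((nat_of_ord (B i j))%:Z - H%:Z).

Definition Phi (R : realType) (n H : nat) : R :=
  \sum_(B : 'M['I_(2 * H).+1]_n | \det (box_to_int B) != 0)
     ((totient `|\det (box_to_int B)|%N)%:R / (`|\det (box_to_int B)|%N)%:R).

Definition sigma_factor (R : realType) (n p : nat) : R :=
  (1 - (p%:R)^-1) * (1 + (p%:R)^-1 * \prod_(2 <= j < n.+1) (1 - (p%:R ^+ j)^-1)).

Definition sigma (R : realType) (n : nat) : R :=
  limn (fun N : nat => (\prod_(p < N | prime p) sigma_factor R n p : R)).

Definition theta (R : realType) (n : nat) : R := 1 - ((n ^ 3).+1%:R)^-1.

(* Main.v *)
(** Expanding [phi(m)/m = prod_(p | m) (1 - 1/p)] over finite sets [S] of primes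
    below a large [N], with [d(S) = prod_(p in S) p], gives
    [Phi(H) = sum_S (-1)^|S| A(S) / d(S)], where [A(S)] counts the nonsingular
    matrices of the box whose determinant is divisible by [d(S)]. The truncated
    Euler product of [sigma] is [sum_S (-1)^|S| rho(S) / d(S)], where [rho(S)] is
    the proportion of matrices modulo [d(S)] with determinant [0]: by the Chinese
    remainder theorem and the order of [GL_n(F_p)], it is the product of the local
    densities [1 - prod_(1 <= i <= n) (1 - p^-i) <= n/p].
    For [d(S) <= H], cutting the box into residue boxes modulo [d(S)] compares
    [A(S)] with [(2H)^(n^2) rho(S)] up to [H^(n^2-1) d(S) rho(S)], and singular
    matrices number [O(H^(n^2-1))]. For [d(S) > H] both terms are bounded
    trivially, using that [det A] has few divisors. Bounds of the form
    [k^|S| = O(d(S)^(1/s))] and the convergence of [sum_d d^(-1-1/s)] control the sum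
    over [S] uniformly in [N], with total error [O(H^(n^2-1+(n+2)/s))] for every
    [s >= 2]; finally [N] tends to infinity. *)
Require Import Defs.
From HB Require Import structures.
From mathcomp Require Import all_boot all_order all_algebra.
From mathcomp Require Import fingroup perm.
From mathcomp Require Import all_classical all_reals all_analysis.
From mathcomp Require Import ring lra zify.
Import Order.TTheory GRing.Theory Num.Theory.
Import numFieldNormedType.Exports.
Local Open Scope ring_scope.
Set Implicit Arguments.
Unset Strict Implicit.
Unset Printing Implicit Defensive.

(** * Finite sets of primes and their squarefree products *)

Definition prime_set N (S : {set 'I_N}) : bool := [forall p in S, prime p].

Definition set_prod N (S : {set 'I_N}) : nat := (\prod_(p in S) p)%N.

Lemma prime_setP N (S : {set 'I_N}) :
  reflect (forall p : 'I_N, p \in S -> prime p) (prime_set S).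
Proof. by apply: (iffP forall_inP). Qed.

Lemma set_prod_gt0 N (S : {set 'I_N}) : prime_set S -> (0 < set_prod S)%N.
Proof. by move/prime_setP=> pS; apply: prodn_cond_gt0 => p /pS/prime_gt0. Qed.

(** Removing one prime leaves a product coprime to it, which is the form needed to evaluate
    multiplicative functions. *)
Lemma prime_set_ind N (P : {set 'I_N} -> Prop) :
  P finset.set0 ->
  (forall (p : 'I_N) (S : {set 'I_N}), prime p -> prime_set S -> p \notin S ->
     coprime p (set_prod S) -> P S -> P (p |: S)%SET) ->
  forall S, prime_set S -> P S.
Proof.
move=> P0 PU S; have [k] := ubnP #|S|; elim: k S => // k IH S leSk /prime_setP pS.
have [->//|[p Sp]] := finset.set_0Vmem S.
rewrite -(finset.setD1K Sp).
have pS' : prime_set (S :\ p).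
  by apply/prime_setP => q /finset.setD1P[_ /pS].
apply: PU => //; first exact: pS.
- by rewrite !inE eqxx.
- rewrite coprime_sym; apply: (big_ind (fun x => coprime x p)) => [|x y|q].
  + exact: coprime1n.
  + by move=> cx cy; rewrite coprimeMl cx.
  + move=> /finset.setD1P[neq /pS prq]; rewrite prime_coprime // dvdn_prime2 //.
    exact: pS.
- by apply: IH => //; rewrite (cardsD1 p S) Sp in leSk.
Qed.

Lemma set_prodU1 N (p : 'I_N) (S : {set 'I_N}) :
  p \notin S -> set_prod (p |: S) = (p * set_prod S)%N.
Proof. by move=> pS; rewrite /set_prod big_setU1. Qed.

Lemma multiplicative_set_prod (A : comPzRingType) (F : nat -> A) N (S : {set 'I_N}) :
  F 1%N = 1 ->
  (forall a b, (0 < a)%N -> (0 < b)%N -> coprime a b -> F (a * b)%N = F a * F b) ->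
  prime_set S -> F (set_prod S) = \prod_(p in S) F p.
Proof.
move=> F1 FM; move: S; apply: prime_set_ind => [|p S pp pS npS cop IH].
  by rewrite /set_prod !finset.big_set0.
rewrite set_prodU1 // FM ?IH ?(prime_gt0 pp) ?set_prod_gt0 //.
by rewrite big_setU1.
Qed.

Lemma dvd_set_prod N (S : {set 'I_N}) (p : 'I_N) m :
  p \in S -> (set_prod S %| m)%N -> (p %| m)%N.
Proof.
move=> Sp; apply: dvdn_trans; rewrite /set_prod (finset.big_setD1 p) //=.
exact: dvdn_mulr.
Qed.

Lemma mem_set_prod N (S : {set 'I_N}) (p : 'I_N) :
  prime_set S -> prime p -> (p \in S) = (p %| set_prod S)%N.
Proof.
move=> /prime_setP pS prp; apply/idP/idP => [Sp|].
  by apply: (@dvd_set_prod _ S).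
rewrite /set_prod => pd; apply/negPn/negP => nSp; move: pd; apply/negP.
rewrite -prime_coprime //.
apply: (big_ind (fun x => coprime p x)) => [|x y|q Sq].
- exact: coprimen1.
- by move=> cx cy; rewrite coprimeMr cx.
- rewrite prime_coprime // dvdn_prime2 ?(pS _ Sq) //.
  by apply: contra nSp => /eqP/val_inj->.
Qed.

Lemma set_prod_inj N (S T : {set 'I_N}) :
  prime_set S -> prime_set T -> set_prod S = set_prod T -> S = T.
Proof.
move=> pS pT eqST; apply/finset.setP => p; case prp: (prime p).
  by rewrite !mem_set_prod // eqST.
by apply/idP/idP => [/(prime_setP _ pS)|/(prime_setP _ pT)]; rewrite prp.
Qed.

Lemma prod_prime_distr (A : comPzRingType) (f : nat -> A) N :
  \prod_(p < N | prime p) (1 - f p) =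
  \sum_(S : {set 'I_N} | prime_set S) (-1) ^+ #|S| * \prod_(p in S) f p.
Proof.
(* A non-prime index gets the summand 0, so every set containing one drops out of the expansion. *)
transitivity (\prod_(p < N) ((if prime p then - f p else 0) + 1)).
  rewrite big_mkcond /=; apply: eq_bigr => p _.
  by case: ifP; rewrite ?add0r // addrC.
rewrite bigA_distr [RHS]big_mkcond /=.
apply: eq_bigr => S _; rewrite -big_mkcond /=.
case: ifPn => [/prime_setP pS|].
  rewrite (eq_bigr (fun p : 'I_N => - f p)) => [|p /pS -> //].
  by rewrite prodrN.
rewrite negb_forall => /existsP[p]; rewrite negb_imply => /andP[Sp npp].
by rewrite (bigD1 p) //= (negPf npp) mul0r.
Qed.

(** The bound [m < N] brings every prime factor of [m] into the range of the product; the other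
    primes contribute factors 1. *)
Lemma totient_div_prod (F : numFieldType) N m :
  (0 < m < N)%N ->
  (totient m)%:R / m%:R =
  \prod_(p < N | prime p) (1 - (p %| m)%N%:R / p%:R) :> F.
Proof.
move=> /andP[m0 mN]; have nz k : (0 < k)%N -> k%:R != 0 :> F.
  by move=> k0; rewrite pnatr_eq0 -lt0n.
have mE : m = (\prod_(p <- primes m) p ^ logn p m)%N.
  by rewrite [LHS](prod_prime_decomp m0) prime_decompE big_map.
rewrite totientE // [X in _ / X%:R]mE.
rewrite !natr_prod -prodf_div.
rewrite -(big_mkord prime (fun p => 1 - (p %| m)%N%:R / p%:R)).
rewrite [RHS](bigID (fun p => p \in primes m)) /= [X in _ = _ * X]big1 => [|p]; last first.
  rewrite mem_primes m0 /= => /andP[->] /=; rewrite ?andTb => /negbTE ->.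
  by rewrite mul0r subr0.
rewrite mulr1 -(filter_pi_of mN) big_filter.
rewrite [RHS](eq_bigl (fun p => p \in \pi(m))) => [|p]; last first.
  rewrite (filter_pi_of mN); apply/andb_idl.
  by rewrite mem_primes => /and3P[].
apply: eq_bigr => p; rewrite -[\pi(m) p]/(p \in primes m) mem_primes => /and3P[pp _ pm].
have lm : (0 < logn p m)%N by rewrite logn_gt0 mem_primes pp m0.
rewrite pm -{2}(prednK lm) expnS !natrM invfM mulrACA divff ?mulr1; last first.
  by rewrite nz // expn_gt0 prime_gt0.
by rewrite -subn1 natrB ?prime_gt0 // mulrBl divff // nz ?prime_gt0.
Qed.

Lemma dvdn_set_prodP N (S : {set 'I_N}) m : prime_set S ->
  (set_prod S %| m)%N = [forall p in S, (p %| m)%N].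
Proof.
move=> pS; apply/idP/forall_inP => [Sm p Sp|].
  exact: (dvd_set_prod Sp Sm).
move: S pS; apply: prime_set_ind => [_|p S pp pS npS cop IH pm].
  by rewrite /set_prod finset.big_set0 dvd1n.
rewrite set_prodU1 // Gauss_dvd // pm ?finset.setU11 //=.
by apply: IH => q Sq; apply: pm; rewrite finset.setU1r.
Qed.

Lemma totient_div_sum (F : numFieldType) N m : (0 < m < N)%N ->
  (totient m)%:R / m%:R =
  \sum_(S : {set 'I_N} | prime_set S)
     (-1) ^+ #|S| * ((set_prod S %| m)%N%:R / (set_prod S)%:R) :> F.
Proof.
move=> mN; rewrite (totient_div_prod F mN) (prod_prime_distr (fun p => (p %| m)%N%:R / p%:R)).
apply: eq_bigr => S pS; congr (_ * _).
rewrite prodf_div [in RHS]/set_prod [in RHS]natr_prod; congr (_ / _).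
rewrite dvdn_set_prodP //.
have [/forall_inP H|] := boolP [forall p in S, (p %| m)%N]; last first.
  case/forall_inPn => p Sp npm; by rewrite (bigD1 p) //= (negbTE npm) mul0r.
by rewrite big1 // => p /H ->.
Qed.

Lemma card_ord_lt N (S : {set 'I_N}) t : (#|[set p in S | (p < t)%N]| <= t)%N.
Proof.
rewrite cardE -(size_map val) -[leqRHS](size_iota 0).
apply: uniq_leq_size; first by rewrite map_inj_uniq ?enum_uniq //; exact: val_inj.
move=> x /mapP[p]; rewrite mem_enum inE => /andP[_ pt] ->.
by rewrite mem_iota.
Qed.

(** Among the [#|S|] factors [t], one indexed by [p >= t] is at most [p], and at most [t] elements
    of [S] lie below [t]. Taking [t = k ^ s] yields [k ^ #|S| = O(set_prod S ^ (1/s))]. *)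
Lemma exp_card_le_set_prod N (S : {set 'I_N}) t : prime_set S -> (0 < t)%N ->
  (t ^ #|S| <= t ^ t * set_prod S)%N.
Proof.
move=> /prime_setP pS t0.
have -> : (t ^ #|S| = \prod_(p in S) t)%N by rewrite prod_nat_const.
apply: (@leq_trans (\prod_(p in S) ((if p < t then t else 1) * p))%N).
  apply: leq_prod => p /pS/prime_gt0 p0; case: ltnP => [_|].
    exact: leq_pmulr.
  by rewrite mul1n.
rewrite big_split /= leq_mul2r -big_mkcondr /=; apply/orP; right.
rewrite (eq_bigl (fun p : 'I_N => p \in [set p in S | (p < t)%N])).
  by rewrite prod_nat_const leq_pexp2l // card_ord_lt.
by move=> p; rewrite inE.
Qed.

(** A divisor bound: the sets counted are subsets of the set [T] of prime divisors of [m] below [N],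
    and [(2 ^ #|T|) ^ s = (2 ^ s) ^ #|T|] is bounded by the previous lemma with [t = 2 ^ s]. *)
Lemma card_set_prod_dvd N m s : (0 < m)%N ->
  (#|[set S : {set 'I_N} | prime_set S && (set_prod S %| m)%N]| ^ s
     <= (2 ^ s) ^ (2 ^ s) * m)%N.
Proof.
move=> m0; set T := [set p : 'I_N | prime p && (p %| m)%N].
have pT : prime_set T by apply/prime_setP => p; rewrite inE => /andP[].
have Tm : (set_prod T %| m)%N.
  by rewrite dvdn_set_prodP //; apply/forall_inP => p; rewrite inE => /andP[].
apply: (@leq_trans ((2 ^ #|T|) ^ s)).
  have: (#|[set S : {set 'I_N} | prime_set S && (set_prod S %| m)%N]| <= 2 ^ #|T|)%N.
    rewrite -card_powerset subset_leq_card //; apply/fintype.subsetP => S.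
    rewrite !inE => /andP[pS Sm]; apply/fintype.subsetP => p Sp.
    by rewrite inE (prime_setP _ pS) //= (dvd_set_prod Sp Sm).
  by case: (s) => // s'; rewrite leq_exp2r.
rewrite -expnM mulnC expnM (leq_trans (exp_card_le_set_prod pT _)) ?expn_gt0 //.
by rewrite leq_mul2l (dvdn_leq m0 Tm) orbT.
Qed.

(** * Determinants divisible by [d]: boxes, residues, multiplicativity *)

Definition shift_mx (n k h : nat) (B : 'M['I_k]_n) : 'M[int]_n :=
  \matrix_(i, j) ((B i j : nat)%:Z - h%:Z).

(** Side [k] and shift [h] are independent: [k = 2H+1], [h = H] is the box of the theorem, [k = d]
    is a full residue system modulo [d] for any shift, and [d = 0] selects the singular matrices. *)
Definition det_dvd_set (n k h d : nat) : {set 'M['I_k]_n} :=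
  [set B | (d%:Z %| \det (shift_mx h B))%Z].

(** Congruences pass through the products and the signed sum of the Leibniz formula. *)
Lemma dvdz_det_sub n (d : int) (A B : 'M[int]_n) :
  (forall i j, (d %| A i j - B i j)%Z) -> (d %| \det A - \det B)%Z.
Proof.
move=> AB; rewrite /determinant -sumrB; apply: (big_ind (fun x => (d %| x)%Z)) => [|x y|s _].
- exact: dvdz0.
- exact: rpredD.
rewrite -mulrBr dvdz_mull //.
apply: (big_ind2 (fun x y => (d %| x - y)%Z)) => [|x1 x2 y1 y2 dx dy|i _].
- by rewrite subrr dvdz0.
- have -> : x1 * y1 - x2 * y2 = (x1 - x2) * y1 + x2 * (y1 - y2) by ring.
  by apply: rpredD; [exact: dvdz_mulr|exact: dvdz_mull].
- exact: AB.
Qed.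

Lemma dvdz_det_congr n (d : int) (A B : 'M[int]_n) :
  (forall i j, (d %| A i j - B i j)%Z) -> (d %| \det A)%Z = (d %| \det B)%Z.
Proof.
move=> /dvdz_det_sub dAB; have -> : \det A = (\det A - \det B) + \det B by ring.
by rewrite rpredDl.
Qed.

Lemma dvdz_subn_mod (d m : nat) (h : nat) :
  (d%:Z %| (m%:Z - h%:Z) - ((m %% d)%N%:Z - h%:Z))%Z.
Proof.
have -> : (m%:Z - h%:Z) - ((m %% d)%N%:Z - h%:Z) = (m %/ d)%N%:Z * d%:Z.
  by rewrite {1}(divn_eq m d) PoszD PoszM; ring.
exact: dvdz_mull.
Qed.

(** The map [(Q, M) -> M + d Q] is injective and keeps the determinant modulo [d]: the box contains
    [q ^ (n * n)] disjoint copies of the residue box. *)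
Lemma leq_card_det_dvd (n k h d q : nat) : (q * d <= k)%N ->
  (q ^ (n * n) * #|det_dvd_set n d h d| <= #|det_dvd_set n k h d|)%N.
Proof.
move=> qdk; have lt_k (M : 'I_d) (Q : 'I_q) : (M + d * Q < k)%N.
  apply: leq_trans qdk; apply: (@leq_trans (d + d * Q)%N); first by rewrite ltn_add2r.
  by rewrite -mulnS mulnC leq_mul2r ltn_ord orbT.
pose f (QM : 'M['I_q]_n * 'M['I_d]_n) : 'M['I_k]_n :=
  \matrix_(i, j) Ordinal (lt_k (QM.2 i j) (QM.1 i j)).
have f_inj : injective f.
  move=> [Q M] [Q' M'] /matrixP eqf.
  have eqQM i j : (Q i j = Q' i j) * (M i j = M' i j).
    have := congr1 val (eqf i j); rewrite !mxE /= => e.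
    have d0 : (0 < d)%N by apply: leq_ltn_trans (ltn_ord (M i j)).
    split; apply: val_inj => /=.
      have := congr1 (divn^~ d) e; rewrite ![(_ + d * _)%N]addnC ![(d * _)%N]mulnC.
      by rewrite !divnMDl // !divn_small // !addn0.
    have := congr1 (modn^~ d) e; rewrite ![(_ + d * _)%N]addnC ![(d * _)%N]mulnC.
    by rewrite !modnMDl !modn_small.
  by congr (_, _); apply/matrixP => i j; rewrite eqQM.
rewrite -{1}(card_ord q) -card_mx -cardsT -cardsX -(card_imset _ f_inj).
apply: subset_leq_card; apply/fintype.subsetP => B /imsetP[[Q M]].
rewrite !inE /= => dM ->; rewrite (@dvdz_det_congr _ _ _ (shift_mx h M)) //.
move=> i j; rewrite !mxE /=.
have -> : (M i j + d * Q i j)%N%:Z - h%:Z - ((M i j)%:Z - h%:Z) = d%:Z * (Q i j)%:Z.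
  by rewrite PoszD PoszM; ring.
exact: dvdz_mulr.
Qed.

(** Conversely, entrywise quotient and remainder by [d] determine a matrix, so [q ^ (n * n)] residue
    boxes cover the box. *)
Lemma card_det_dvd_leq (n k h d q : nat) : (0 < d)%N -> (k <= q * d)%N ->
  (#|det_dvd_set n k h d| <= q ^ (n * n) * #|det_dvd_set n d h d|)%N.
Proof.
move=> d0 kqd.
have lt_q (B : 'I_k) : (B %/ d < q)%N.
  by rewrite ltn_divLR // (leq_trans (ltn_ord B)).
have lt_d (B : 'I_k) : (B %% d < d)%N by rewrite ltn_mod.
pose f (B : 'M['I_k]_n) : 'M['I_q]_n * 'M['I_d]_n :=
  (\matrix_(i, j) Ordinal (lt_q (B i j)), \matrix_(i, j) Ordinal (lt_d (B i j))).
have f_inj : injective f.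
  move=> B C [/matrixP eqQ /matrixP eqM]; apply/matrixP => i j.
  have := congr1 val (eqM i j); have := congr1 val (eqQ i j); rewrite !mxE /= => e1 e2.
  by apply: val_inj; rewrite /= (divn_eq (B i j) d) e1 e2 -divn_eq.
rewrite -{1}(card_ord q) -card_mx -cardsT -cardsX -(card_imset _ f_inj).
apply: subset_leq_card; apply/fintype.subsetP => _ /imsetP[B + ->].
rewrite !inE /= => dB; rewrite -(@dvdz_det_congr _ _ (shift_mx h B)) //.
by move=> i j; rewrite !mxE /=; exact: dvdz_subn_mod.
Qed.

(** The Chinese remainder theorem applied to each entry; injectivity suffices because the
    cardinalities agree. *)
Lemma card_det_dvdM (n h a b : nat) : (0 < a)%N -> (0 < b)%N -> coprime a b ->
  #|det_dvd_set n (a * b) h (a * b)| =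
  (#|det_dvd_set n a h a| * #|det_dvd_set n b h b|)%N.
Proof.
move=> a0 b0 cab.
have lt_a (B : 'I_(a * b)) : (B %% a < a)%N by rewrite ltn_mod.
have lt_b (B : 'I_(a * b)) : (B %% b < b)%N by rewrite ltn_mod.
pose f (B : 'M['I_(a * b)]_n) : 'M['I_a]_n * 'M['I_b]_n :=
  (\matrix_(i, j) Ordinal (lt_a (B i j)), \matrix_(i, j) Ordinal (lt_b (B i j))).
have f_inj : injective f.
  move=> B C [/matrixP eqQ /matrixP eqM]; apply/matrixP => i j.
  have := congr1 val (eqM i j); have := congr1 val (eqQ i j); rewrite !mxE /= => e1 e2.
  apply: val_inj => /=; rewrite -(modn_small (ltn_ord (B i j))) -(modn_small (ltn_ord (C i j))).
  by apply/eqP; rewrite chinese_remainder // e1 e2 !eqxx.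
have f_bij : bijective f.
  apply: inj_card_bij => //.
  by rewrite card_prod !card_mx !card_ord expnMn.
rewrite -cardsX -(on_card_preimset (onW_bij _ f_bij)).
apply: eq_card => B; rewrite !inE /= PoszM Gauss_dvdz //.
congr (_ && _); apply: dvdz_det_congr => i j; rewrite !mxE /=; exact: dvdz_subn_mod.
Qed.

(** * Density of singular matrices modulo a prime *)

Lemma intr_Fp_eq0 (p : nat) (z : int) : prime p ->
  (z%:~R == 0 :> 'F_p) = (p%:Z %| z)%Z.
Proof.
move=> pp; case: z => m; rewrite dvdzE ?NegzE ?abszN /=.
  by rewrite -(dvdn_pcharf (pchar_Fp pp)).
by rewrite mulrNz oppr_eq0 -(dvdn_pcharf (pchar_Fp pp)).
Qed.

(** A shifted box of side [p] reduces bijectively onto the matrices over ['F_p], and the complement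
    of the counted set reduces onto the invertible ones. *)
Lemma card_det_dvd_prime (n h p : nat) : prime p ->
  (#|det_dvd_set n.+1 p h p| + #|('GL_n.+1['F_p])%g| = p ^ (n.+1 * n.+1))%N.
Proof.
move=> pp.
pose f (B : 'M['I_p]_n.+1) : 'M['F_p]_n.+1 := map_mx intr (shift_mx h B).
have f_inj : injective f.
  move=> B C /matrixP eqf; apply/matrixP => i j; apply: val_inj => /=.
  have := eqf i j; rewrite !mxE /= => /eqP.
  rewrite -subr_eq0 -rmorphB intr_Fp_eq0 //= opprB addrA subrK.
  rewrite -eqz_mod_dvd => /eqP; rewrite !modz_nat => -[].
  by rewrite !modn_small.
have f_bij : bijective f
  by apply: inj_card_bij => //; rewrite !card_mx !card_ord Fp_cast.
have -> : #|('GL_n.+1['F_p])%g| = #|[set A : 'M['F_p]_n.+1 | A \in unitmx]|.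
  by rewrite cardsT card_sub; apply: eq_card => A; rewrite !inE.
rewrite -[X in (_ + X)%N](on_card_preimset (onW_bij _ f_bij)).
rewrite [X in (_ + X)%N](_ : _ = #|~: det_dvd_set n.+1 p h p|).
  by rewrite cardsC card_mx card_ord.
apply: eq_card => B; rewrite !inE unitmxE unitfE /f det_map_mx.
by rewrite intr_Fp_eq0.
Qed.

Lemma bin2_add_bin2S n : ('C(n, 2) + 'C(n.+1, 2) = n * n)%N.
Proof.
by elim: n => // n IH; rewrite binS bin1 [in LHS](binS n.+1) bin1; lia.
Qed.

(** With [r = n.+1], the order of [GL_r] is [p ^ 'C(r, 2)] times the product of the [p ^ i - 1].
    Pulling [p ^ i] out of each factor adds the exponent ['C(r.+1, 2)], for a total of [r * r]. *)
Lemma card_det_dvd_prime_density (F : numFieldType) (n h p : nat) : prime p ->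
  #|det_dvd_set n.+1 p h p|%:R / p%:R ^+ (n.+1 * n.+1) =
  1 - \prod_(1 <= i < n.+2) (1 - (p%:R ^+ i)^-1) :> F.
Proof.
move=> pp; have p0 : p%:R != 0 :> F by rewrite pnatr_eq0 -lt0n prime_gt0.
have /(congr1 (fun m => m%:R : F)) := card_det_dvd_prime n h pp.
rewrite natrD natrX => /(canRL (addrK _)) ->.
rewrite mulrBl divff ?expf_neq0 //; congr (1 - _).
rewrite card_GL // card_Fp // natrM natr_prod natrX.
have -> : \prod_(1 <= i < n.+2) (p ^ i - 1)%N%:R =
   p%:R ^+ 'C(n.+2, 2) * \prod_(1 <= i < n.+2) (1 - (p%:R ^+ i)^-1) :> F.
  rewrite -bin2_sum [X in _ ^+ X]big_ltn // add0n expr_sum -big_split /=. 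
  apply: eq_bigr => i _; rewrite natrB ?expn_gt0 ?prime_gt0 // natrX.
  by rewrite mulrBr mulr1 divff ?expf_neq0.
by rewrite mulrA -exprD bin2_add_bin2S mulrAC divff ?mul1r ?expf_neq0.
Qed.

(** * Counting singular matrices in a box *)

Lemma card_fibre_leq (T U : finType) (f : T -> U) (A : {set T}) m :
  (forall x, x \in A -> (#|[set y in A | f y == f x]| <= m)%N) ->
  (#|A| <= m * #|f @: A|)%N.
Proof.
move=> fib; rewrite -sum1_card (partition_big_imset f) /=.
rewrite mulnC -sum_nat_const; apply: leq_sum => _ /imsetP[x Ax ->].
rewrite sum1_card; apply: leq_trans (fib x Ax).
by apply: subset_leq_card; apply/fintype.subsetP => y; rewrite inE.
Qed.

(** Overwriting the corner by an arbitrary value loses no information when the old corner is known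
    to be [c]. *)
Lemma card_mx_entry_fixed (T : finType) n (c : T) :
  (#|[set M : 'M[T]_n.+1 | M ord0 ord0 == c]| * #|T| <= #|T| ^ (n.+1 * n.+1))%N.
Proof.
pose f (Mx : 'M[T]_n.+1 * T) : 'M[T]_n.+1 :=
  \matrix_(i, j) if (i == ord0) && (j == ord0) then Mx.2 else Mx.1 i j.
set A := [set _ | _].
have f_inj : {in finset.setX A finset.setT &, injective f}.
  move=> [M x] [M' x']; rewrite !inE /= => /andP[/eqP M0 _] /andP[/eqP M0' _].
  move=> /matrixP e; congr (_, _).
    apply/matrixP => i j; have := e i j; rewrite !mxE /=.
    by case: ifP => // /andP[/eqP -> /eqP ->]; rewrite M0 M0'.
  by have := e ord0 ord0; rewrite !mxE !eqxx.
rewrite -[X in (_ * X)%N]cardsT -cardsX -(card_in_imset f_inj) -card_mx.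
exact: max_card.
Qed.

Lemma horner_char_poly (R : comNzRingType) n (A : 'M[R]_n) (t : R) :
  (char_poly A).[t] = \det (t%:M - A).
Proof.
rewrite -[LHS]/(horner_eval t _) -det_map_mx; congr (\det _).
apply/matrixP => i j; rewrite !mxE /= /horner_eval.
by rewrite hornerD hornerN hornerC hornerMn hornerX.
Qed.

(* Singular matrices are grouped along the lines [A + t I]: each line meets the
   determinantal hypersurface in at most [n] points, the eigenvalues of [-A]. *)
Lemma card_det_eq0_leq (n k h : nat) :
  (#|det_dvd_set n.+1 k h 0| * (2 * k) <= n.+1 * (2 * k) ^ (n.+1 * n.+1))%N.
Proof.
have lt2k (B : 'M['I_k]_n.+1) i j :
    (B i j + (if i == j then k - B ord0 ord0 else 0) < 2 * k)%N.
  by have := ltn_ord (B i j); case: ifP; lia.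
(* [f] moves [B] along its line until the corner equals [k], which selects one representative per
   line; the entries stay below [2 * k]. *)
pose f (B : 'M['I_k]_n.+1) : 'M['I_(2 * k)]_n.+1 := \matrix_(i, j) Ordinal (lt2k B i j).
have [k0|k0] := posnP k.
  have -> : (2 * k = 0)%N by lia.
  by rewrite muln0.
have ltk2k : (k < 2 * k)%N by lia.
set Z := det_dvd_set _ _ _ _.
have card_im : (#|f @: Z| * (2 * k) <= (2 * k) ^ (n.+1 * n.+1))%N.
  have := card_mx_entry_fixed n (Ordinal ltk2k); rewrite card_ord; apply: leq_trans.
  rewrite leq_mul2r; apply/orP; right; apply: subset_leq_card.
  apply/fintype.subsetP => _ /imsetP[B _ ->]; rewrite !inE mxE -val_eqE /=.
  by apply/eqP; rewrite ?eqxx subnKC // ltnW.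
apply: (@leq_trans (n.+1 * (#|f @: Z| * (2 * k)))); last by rewrite leq_mul2l card_im orbT.
rewrite [leqRHS]mulnA leq_mul2r; apply/orP; right; apply: card_fibre_leq => B ZB.
set fib := [set _ in _ | _].
(* For [C] on the line of [B], [g C] is a root of the characteristic polynomial of [shift_mx h B],
   since [- shift_mx h C] is singular. *)
pose g (C : 'M['I_k]_n.+1) : int := (B ord0 ord0)%:Z - (C ord0 ord0)%:Z.
have shiftE C : C \in fib -> (g C)%:M - shift_mx h B = - shift_mx h C.
  rewrite inE => /andP[_ /eqP/matrixP e]; apply/matrixP => i j; rewrite !mxE /g.
  have /(congr1 val) := e i j; rewrite !mxE /=.
  have := ltn_ord (B ord0 ord0); have := ltn_ord (C ord0 ord0).
  by case: (i == j); rewrite ?mulr1n ?mulr0n;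
    move: (nat_of_ord _) (nat_of_ord _) (nat_of_ord _) (nat_of_ord _) => a b c d; lia.
have g_inj : {in fib &, injective g}.
  move=> C D fC fD eqg; have := shiftE D fD; rewrite -eqg (shiftE C fC).
  move=> /oppr_inj /matrixP e; apply/matrixP => i j; apply: val_inj => /=.
  by have := e i j; rewrite !mxE; lia.
rewrite cardE -(size_map g) -ltnS -(size_char_poly (shift_mx h B)).
apply: max_poly_roots.
- by rewrite -size_poly_eq0 size_char_poly.
- apply/allP => _ /mapP[C + ->]; rewrite mem_enum => fC.
  rewrite rootE horner_char_poly shiftE // -scaleN1r detZ mulf_eq0.
  move: fC; rewrite inE => /andP[+ _]; rewrite inE dvd0z => ->.
  by rewrite orbT.
- by rewrite map_inj_in_uniq ?enum_uniq // => C D; rewrite !mem_enum; apply: g_inj.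
Qed.

Lemma abs_det_leq n (A : 'M[int]_n) (H : nat) :
  (forall i j, `|A i j| <= H%:Z) -> `|\det A| <= (n`! * H ^ n)%N%:Z.
Proof.
move=> AH; apply: le_trans (ler_norm_sum _ _ _) _.
apply: (@le_trans _ _ (\sum_(s : {perm 'I_n}) (H ^ n)%N%:Z)).
  apply: ler_sum => s _; rewrite normrM normrX normrN1 expr1n mul1r normr_prod.
  apply: (@le_trans _ _ (\prod_(i < n) H%:Z)).
    by apply: ler_prod => i _; rewrite normr_ge0 AH.
  by rewrite prodr_const card_ord -!natz natrX.
by rewrite sumr_const card_Sn -mulr_natl PoszM natz.
Qed.

(** * Real [s]-th roots, which carry the fractional exponents, and a convergent series *)

Definition nroot (R : realType) (s : nat) (x : R) : R := x `^ (s%:R^-1).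

Lemma nroot_ge0 (R : realType) s (x : R) : 0 <= nroot s x.
Proof. exact: powR_ge0. Qed.

Lemma nrootX (R : realType) s (x : R) : (0 < s)%N -> 0 <= x -> nroot s x ^+ s = x.
Proof.
move=> s0 x0; rewrite -powR_mulrn ?nroot_ge0 // -powRrM mulVf ?powRr1 //.
by rewrite pnatr_eq0 -lt0n.
Qed.

Lemma nrootM (R : realType) s (x y : R) : 0 <= x -> 0 <= y ->
  nroot s (x * y) = nroot s x * nroot s y.
Proof. by move=> x0 y0; rewrite /nroot powRM. Qed.

Lemma nroot_exp (R : realType) s (x : R) n : 0 <= x -> nroot s (x ^+ n) = nroot s x ^+ n.
Proof.
by move=> x0; rewrite /nroot -!powR_mulrn ?powR_ge0 // -!powRrM mulrC.
Qed.

Lemma ler_nroot (R : realType) s (x y : R) : 0 <= x -> x <= y -> nroot s x <= nroot s y.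
Proof.
move=> x0 xy; apply: ge0_ler_powR; rewrite ?nnegrE ?invr_ge0 //.
exact: le_trans xy.
Qed.

Lemma le_nroot (R : realType) s (x y : R) : (0 < s)%N -> 0 <= x ->
  x ^+ s <= y -> x <= nroot s y.
Proof.
move=> s0 x0 xy; have y0 : 0 <= y by rewrite (le_trans _ xy) // exprn_ge0.
by rewrite -(@ler_pXn2r _ s) ?nnegrE ?nroot_ge0 ?nrootX.
Qed.

Lemma nroot_ge1 (R : realType) s (x : R) : (0 < s)%N -> 1 <= x -> 1 <= nroot s x.
Proof. by move=> s0 x1; apply: le_nroot; rewrite ?expr1n. Qed.

(** The exponent [2/s - 1] is at most 0 for [s >= 2]; identity [E] below expresses the quotient by
    the natural exponent [s - 2]. *)
Lemma nroot_sqr_div_anti (R : realType) s (x y : R) : (1 < s)%N -> 0 < x -> x <= y ->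
  nroot s y ^+ 2 / y <= nroot s x ^+ 2 / x.
Proof.
move=> s1 x0 xy; have y0 : 0 < y by exact: lt_le_trans xy.
have s0 : (0 < s)%N by apply: ltnW.
have rx : 0 < nroot s x by rewrite powR_gt0.
have ry : 0 < nroot s y by rewrite powR_gt0.
have E (z : R) : 0 < z -> nroot s z ^+ 2 / z = (nroot s z ^+ (s - 2))^-1.
  move=> z0; have rz : nroot s z != 0 by rewrite gt_eqF // powR_gt0.
  have -> : z^-1 = (nroot s z ^+ (s - 2) * nroot s z ^+ 2)^-1.
    by rewrite -exprD subnK // nrootX // ltW.
  by rewrite invfM mulrCA divff ?mulr1 // expf_neq0.
rewrite !E // lef_pV2 ?posrE ?exprn_gt0 // lerXn2r ?nnegrE ?nroot_ge0 //.
by rewrite ler_nroot // ltW.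
Qed.

(** For [a], [c] the [s]-th roots of [d - 1] and [d], the left side is [d ^ (-1 - 1/s)] and the
    right side telescopes. It follows from [1 = c ^ s - a ^ s <= (c - a) * s * c ^ (s - 1)]. *)
Lemma inv_root_telescope (F : realFieldType) (a c : F) s : 0 < a -> a <= c ->
  c ^+ s = a ^+ s + 1 -> (c ^+ s * c)^-1 <= s%:R * (a^-1 - c^-1).
Proof.
move=> a0 ac E; have c0 : 0 < c by exact: lt_le_trans ac.
case: s E => [|s] E.
  by move: E; rewrite !expr0 => /eqP; rewrite eq_sym addrC -subr_eq0 addrK oner_eq0.
have H1 : 1 <= (c - a) * (s.+1%:R * c ^+ s).
  rewrite [leLHS](_ : 1 = c ^+ s.+1 - a ^+ s.+1); last by rewrite E addrC addKr.
  rewrite subrXX ler_wpM2l ?subr_ge0 //.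
  rewrite -[in leRHS](card_ord s.+1) mulr_natl -sumr_const ler_sum // => i _ /=.
  rewrite -[in leRHS](subnK (ltn_ord i : i <= s)%N) exprD ler_wpM2l ?exprn_ge0 ?(ltW c0) //.
  by rewrite lerXn2r ?nnegrE ?(ltW a0) ?(ltW c0).
have -> : a^-1 - c^-1 = (c - a) / (a * c) by field; rewrite !gt_eqF.
rewrite mulrA ler_pdivlMr ?mulr_gt0 //.
have -> : (c ^+ s.+1 * c)^-1 * (a * c) = (a / c) / c ^+ s.
  by rewrite exprS; field; rewrite expf_neq0 ?gt_eqF.
rewrite ler_pdivrMr ?exprn_gt0 //.
apply: (@le_trans _ _ 1); first by rewrite ler_pdivrMr // mul1r.
by rewrite mulrC mulrA (mulrC _ (s.+1%:R)) -mulrA; lra.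
Qed.

Lemma sum_inv_nroot_le (R : realType) s M : (0 < s)%N ->
  \sum_(d < M) (d%:R * nroot s d%:R)^-1 <= 1 + s%:R :> R.
Proof.
move=> s0.
(* The term [d = 0] vanishes because the inverse of 0 is 0, the term [d = 1] equals 1, and the
   remaining terms telescope. *)
suff H m : \sum_(d < m.+2) (d%:R * nroot s d%:R)^-1
           <= 1 + s%:R * (1 - (nroot s m.+1%:R)^-1) :> R.
  apply: (@le_trans _ _ (\sum_(d < M.+2) (d%:R * nroot s d%:R)^-1 : R)).
    rewrite !big_ord_recr /= -addrA ler_wpDr // addr_ge0 //;
    by rewrite invr_ge0 mulr_ge0 ?nroot_ge0.
  apply: le_trans (H M) _; rewrite lerD2l ler_piMr // gerBl invr_ge0.
  exact: nroot_ge0.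
elim: m => [|m IH].
  rewrite !big_ord_recl big_ord0 /= mul0r invr0 add0r addr0.
  by rewrite /nroot powR1 mul1r invr1 subrr mulr0 addr0.
rewrite big_ord_recr /=; apply: le_trans (lerD IH (_ : _ <= s%:R *
   ((nroot s m.+1%:R)^-1 - (nroot s m.+2%:R)^-1))) _; last by lra.
rewrite -{1}(nrootX s0 (ler0n R m.+2)).
apply: inv_root_telescope; first by rewrite powR_gt0.
  by rewrite ler_nroot // ler_nat.
by rewrite !nrootX // -natr1.
Qed.

(** Distinct sets of primes have distinct products, so the sum is part of a sum over integers; the
    bound is uniform in [N]. *)
Lemma sum_set_prod_le (F : numDomainType) (g : nat -> F) N (C : F) :
  (forall d, 0 <= g d) -> (forall M, \sum_(d < M) g d <= C) ->
  \sum_(S : {set 'I_N} | prime_set S) g (set_prod S) <= C.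
Proof.
move=> g0 gC; pose M := (\max_(S : {set 'I_N}) set_prod S)%N.
have ltM (S : {set 'I_N}) : (set_prod S < M.+1)%N by rewrite ltnS leq_bigmax.
pose h S := Ordinal (ltM S).
apply: le_trans (gC M.+1).
have -> : \sum_(S : {set 'I_N} | prime_set S) g (set_prod S) =
    \sum_(d in h @: [set S | prime_set S]) g d.
  rewrite big_imset /=; first by apply: eq_bigl => S; rewrite inE.
  by move=> S T; rewrite !inE => pS pT /(congr1 val); apply: set_prod_inj.
rewrite [leRHS](bigID (mem (h @: [set S | prime_set S]))) /= ler_wpDr //.
exact: sumr_ge0.
Qed.

(** * Local densities and counting in the box for small [d] *)

Definition local_density (F : fieldType) (n p : nat) : F :=
  1 - \prod_(1 <= i < n.+1) (1 - (p%:R ^+ i)^-1).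

(** The factor [i = 1] of the density is [1 - 1/p]. This puts the Euler factor in the shape
    [1 - f p] that [prod_prime_distr] expands. *)
Lemma sigma_factorE (R : realType) n p : (0 < n)%N ->
  sigma_factor R n p = 1 - local_density R n p / p%:R.
Proof.
move=> n0; rewrite /sigma_factor /local_density [in RHS]big_ltn // expr1.
ring.
Qed.

(** One minus a product of factors [1 - x_i], with [x_i] in [[0, 1]], is at most the sum of the
    [x_i], and here each [x_i] is at most [1/p]. *)
Lemma local_density_bound (F : realFieldType) n p : (0 < p)%N ->
  0 <= local_density F n p <= n%:R / p%:R /\ local_density F n p <= 1.
Proof.
move=> p0; have p1 : 1 <= p%:R :> F by rewrite ler1n.
have pp : 0 < p%:R :> F by rewrite ltr0n.
pose P n : F := \prod_(1 <= i < n.+1) (1 - (p%:R ^+ i)^-1).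
have x0 i : 0 <= (p%:R ^+ i)^-1 :> F by rewrite invr_ge0 exprn_ge0 // ltW.
have x1 i : (p%:R ^+ i.+1)^-1 <= p%:R^-1 :> F.
  by rewrite lef_pV2 ?posrE ?exprn_gt0 // ler_eXnr.
have xle1 : p%:R^-1 <= 1 :> F by rewrite invf_le1.
suff [/andP[P0 P1] Pn] : 0 <= P n <= 1 /\ 1 - P n <= n%:R / p%:R.
  by rewrite /local_density -/(P n) subr_ge0 gerBl P0 P1 Pn.
elim: n => [|m [/andP[P0 P1] Pm]].
  by rewrite /P big_nil ler01 lexx subrr mul0r lexx.
have -> : P m.+1 = P m * (1 - (p%:R ^+ m.+1)^-1) by rewrite /P big_nat_recr.
have := x0 m.+1; have := x1 m; set x := (p%:R ^+ m.+1)^-1 => xp xx0.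
split; first by apply/andP; split; nra.
rewrite -natr1 mulrDl mul1r; nra.
Qed.

Lemma card_det_dvd_density (F : numFieldType) n h N (S : {set 'I_N}) : prime_set S ->
  #|det_dvd_set n.+1 (set_prod S) h (set_prod S)|%:R /
     (set_prod S)%:R ^+ (n.+1 * n.+1) = \prod_(p in S) local_density F n.+1 p.
Proof.
move=> pS; pose D d : F := #|det_dvd_set n.+1 d h d|%:R / d%:R ^+ (n.+1 * n.+1).
rewrite -/(D _) (multiplicative_set_prod _ _ pS).
- by apply: eq_bigr => p /(prime_setP _ pS) pp; rewrite /D card_det_dvd_prime_density.
- rewrite /D expr1n divr1 (_ : det_dvd_set _ _ _ _ = [set: _]).
    by rewrite cardsT card_mx card_ord exp1n.
  by apply/finset.setP => B; rewrite !inE dvd1z.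
- move=> a b a0 b0 cab; rewrite /D card_det_dvdM // !natrM exprMn invfM.
  by rewrite mulrACA.
Qed.

Lemma prod_local_density_bound (F : realFieldType) n N (S : {set 'I_N}) : prime_set S ->
  0 <= \prod_(p in S) local_density F n p <= n%:R ^+ #|S| / (set_prod S)%:R.
Proof.
move=> /prime_setP pS; apply/andP; split.
  by apply: prodr_ge0 => p /pS/prime_gt0/(local_density_bound F n)[/andP[]].
have -> : n%:R ^+ #|S| / (set_prod S)%:R = \prod_(p in S) (n%:R / p%:R) :> F.
  by rewrite prodf_div prodr_const natr_prod.
by apply: ler_prod => p /pS/prime_gt0/(local_density_bound F n)[].
Qed.

Lemma exprS_sub_expr_le (F : realFieldType) (q : F) m : 0 <= q ->
  (q + 1) ^+ m.+1 - q ^+ m.+1 <= m.+1%:R * (q + 1) ^+ m.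
Proof.
move=> q0; rewrite subrXX addrAC subrr add0r mul1r.
rewrite -[in leRHS](card_ord m.+1) mulr_natl -sumr_const ler_sum // => i _ /=.
have q1 : 0 <= q + 1 by lra.
rewrite -[in leRHS](subnK (ltn_ord i : i <= m)%N) exprD ler_wpM2l ?exprn_ge0 //.
by apply: lerXn2r; rewrite ?nnegrE //; lra.
Qed.

(** The count and the main term both lie between [q ^ m.+1] and [q.+1 ^ m.+1] times the count for
    the residue box. The density is kept as a factor of the error: its decay later compensates the
    factor [d]. *)
Lemma box_count_error (F : realFieldType) n H d m : (0 < d <= H)%N ->
  (n * n = m.+1)%N ->
  `|#|det_dvd_set n (2 * H).+1 H d|%:R
     - (2 * H)%:R ^+ m.+1 * (#|det_dvd_set n d H d|%:R / d%:R ^+ m.+1)|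
  <= m.+1%:R * (3 * H)%:R ^+ m * d%:R * (#|det_dvd_set n d H d|%:R / d%:R ^+ m.+1) :> F.
Proof.
move=> /andP[d0 dH] nm; set q := (2 * H %/ d)%N.
have qd : (q * d <= (2 * H).+1)%N by rewrite leqW // leq_trunc_div.
have qd1 : ((2 * H).+1 <= q.+1 * d)%N by rewrite ltn_ceil.
have := leq_card_det_dvd n H qd; have := card_det_dvd_leq n H d0 qd1; rewrite nm.
set N := #|det_dvd_set n d H d|; set T := #|_|.
rewrite -!(ler_nat F) ![(_ ^ _ * _)%:R]natrM !natrX.
have dp : 0 < d%:R :> F by rewrite ltr0n.
set X : F := (2 * H)%:R / d%:R.
have qX : q%:R <= X by rewrite ler_pdivlMr // -natrM ler_nat leq_trunc_div.
have Xq : X <= q%:R + 1.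
  by rewrite ler_pdivrMr // natr1 -natrM ler_nat ltnW.
have -> : (2 * H)%:R ^+ m.+1 * (N%:R / d%:R ^+ m.+1) = X ^+ m.+1 * N%:R :> F.
  by rewrite /X expr_div_n mulrA mulrAC.
have -> : m.+1%:R * (3 * H)%:R ^+ m * d%:R * (N%:R / d%:R ^+ m.+1) =
   m.+1%:R * ((3 * H)%:R / d%:R) ^+ m * N%:R :> F.
  by rewrite expr_div_n exprSr; field; rewrite expf_neq0 ?gt_eqF.
have q0 : 0 <= q%:R :> F by [].
have N0 : 0 <= N%:R :> F by [].
have X0 : 0 <= X by apply: le_trans qX.
have h1 : q%:R ^+ m.+1 * N%:R <= X ^+ m.+1 * N%:R :> F.
  by rewrite ler_wpM2r // lerXn2r ?nnegrE.
have h2 : X ^+ m.+1 * N%:R <= q.+1%:R ^+ m.+1 * N%:R :> F.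
  by rewrite ler_wpM2r // lerXn2r ?nnegrE // -natr1.
(* Here [d <= H] enters: [(q + 1) * d <= 2 * H + d <= 3 * H]. *)
have h3 : (q.+1%:R ^+ m.+1 - q%:R ^+ m.+1) * N%:R <=
   m.+1%:R * ((3 * H)%:R / d%:R) ^+ m * N%:R :> F.
  rewrite ler_wpM2r // -natr1; apply: le_trans (exprS_sub_expr_le m q0) _.
  rewrite ler_wpM2l // lerXn2r ?nnegrE ?addr_ge0 // ?divr_ge0 //.
  rewrite ler_pdivlMr // natr1 -natrM ler_nat mulSn.
  by have := leq_trunc_div (2 * H) d; rewrite -/q; lia.
move: h1 h2 h3; rewrite mulrBl ler_norml.
move: (q.+1%:R ^+ m.+1 * _) (q%:R ^+ m.+1 * _) (X ^+ _ * _) (_ * _ * N%:R) T%:R.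
by move=> *; lra.
Qed.

(** * Error contributed by one set of primes *)

Lemma exp_card_le_nroot (R : realType) s n N (S : {set 'I_N}) :
  (0 < s)%N -> (0 < n)%N -> prime_set S ->
  n%:R ^+ #|S| <= nroot s ((n ^ s) ^ (n ^ s))%:R * nroot s (set_prod S)%:R :> R.
Proof.
move=> s0 n0 pS; rewrite -nrootM // -natrM; apply: le_nroot => //.
by rewrite -!natrX ler_nat -expnM mulnC expnM exp_card_le_set_prod // expn_gt0 n0.
Qed.

Definition nonsing_dvd_set (n H d : nat) : {set 'M['I_(2 * H).+1]_n} :=
  [set B | (\det (shift_mx H B) != 0) && (d%:Z %| \det (shift_mx H B))%Z].

Lemma card_det_dvd_split n H d :
  #|det_dvd_set n (2 * H).+1 H d| =
  (#|nonsing_dvd_set n H d| + #|det_dvd_set n (2 * H).+1 H 0|)%N.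
Proof.
rewrite -(cardsID (det_dvd_set n (2 * H).+1 H 0)) addnC; congr (_ + _)%N.
  by apply: eq_card => B; rewrite !inE dvd0z.
apply: eq_card => B; rewrite !inE dvd0z; apply/andb_idl => /eqP ->.
exact: dvdz0.
Qed.

(** The constant 6 comes from [2 * (2 * H + 1) <= 6 * H]. *)
Lemma card_box_singular_le (F : realFieldType) n H m : (n.+1 * n.+1 = m.+1)%N ->
  (0 < H)%N ->
  #|det_dvd_set n.+1 (2 * H).+1 H 0|%:R <= n.+1%:R * (6 * H)%:R ^+ m :> F.
Proof.
move=> nm H0; have := card_det_eq0_leq n (2 * H).+1 H.
rewrite nm expnS [leqRHS]mulnCA [leqLHS]mulnC leq_pmul2l // -(ler_nat F).
move=> /le_trans; apply; rewrite -natrX -natrM ler_nat leq_mul2l /=.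
by case: (m) => // m'; rewrite leq_exp2r //; lia.
Qed.

(** One bound serves both ranges of [d = set_prod S]. The first term is summed over [S] by the
    divisor bound, the second through the summable weight [d ^ (-1 - 1/s)], at the cost of
    [H ^ (2/s)]. *)
Lemma set_error (R : realType) n H m s N (S : {set 'I_N}) (K : R) :
  (n.+1 * n.+1 = m.+1)%N -> (0 < H)%N -> (1 < s)%N -> prime_set S -> 0 <= K ->
  n.+1%:R ^+ #|S| <= K * nroot s (set_prod S)%:R ->
  `|#|nonsing_dvd_set n.+1 H (set_prod S)|%:R -
      (2 * H)%:R ^+ m.+1 * \prod_(p in S) local_density R n.+1 p| / (set_prod S)%:R
  <= #|nonsing_dvd_set n.+1 H (set_prod S)|%:R / H%:R +
     6 ^+ m.+1 * (m.+1%:R * K + n.+1%:R) * H%:R ^+ m * nroot s H%:R ^+ 2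
       * ((set_prod S)%:R * nroot s (set_prod S)%:R)^-1.
Proof.
move=> nm H0 s1 pS K0 SK; have s0 : (0 < s)%N by apply: ltnW.
have dens := card_det_dvd_density R n H pS.
have /andP[rho0 rho1] := prod_local_density_bound R n.+1 pS.
have d0 : (0 < set_prod S)%N by exact: set_prod_gt0.
move: d0 rho0 rho1 SK dens; set rho := \prod_(p in S) _.
move: (set_prod S) => d d0 rho0 rho1 SK dens.
have dp : 0 < d%:R :> R by rewrite ltr0n.
have Hp : 0 < H%:R :> R by rewrite ltr0n.
have rhoK : rho <= K * nroot s d%:R / d%:R.
  by apply: le_trans rho1 _; rewrite ler_wpM2r ?invr_ge0.
set A := #|_|; set rH := nroot s H%:R; set rd := nroot s d%:R.
have rdp : 0 < rd by rewrite powR_gt0.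
have rd1 : 1 <= rd by rewrite nroot_ge1 // ler1n.
have rH1 : 1 <= rH by rewrite nroot_ge1 // ler1n.
set w := (d%:R * rd)^-1.
have w0 : 0 < w by rewrite invr_gt0 mulr_gt0.
have dw : d%:R^-1 = rd * w by rewrite /w invfM mulrCA divff ?mulr1 // gt_eqF.
set C1 := m.+1%:R * K + n.+1%:R.
have A0 : 0 <= A%:R :> R by [].
pose P : R := 6 ^+ m.+1 * H%:R ^+ m.
have P0 : 0 < P by rewrite mulr_gt0 ?exprn_gt0.
have Ple c : (c <= 6)%N -> (c * H)%:R ^+ m <= P.
  move=> c6; rewrite natrM exprMn /P ler_wpM2r ?exprn_ge0 //.
  apply: (@le_trans _ _ (6 ^+ m)); last by rewrite ler_weXn2l ?ler1n.
  by rewrite lerXn2r ?nnegrE ?ler_nat.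
(* The density is [O(d ^ (1/s) / d)], that is [d ^ (2/s)] times the weight [w]. *)
have drho : rho <= K * rd ^+ 2 * w.
  by rewrite expr2 !mulrA -[leRHS]mulrA -dw.
rewrite [X in _ <= _ + X](_ : _ = P * C1 * rH ^+ 2 * w); last first.
  by rewrite /P /C1 -!mulrA; congr (_ * _); rewrite mulrCA.
(* For [d <= H], dividing the box error by [d] leaves [H ^ m * rho], to which the singular matrices
   are added; the term [A / H] is nonnegative and is dropped. *)
have [dH|Hd] := leqP d H.
- have rdH : rd <= rH by rewrite ler_nroot // ler_nat.
  have rd2 : rd <= rH ^+ 2 by nra.
  have rd22 : rd ^+ 2 <= rH ^+ 2 by rewrite lerXn2r ?nnegrE ?nroot_ge0.
  have := @box_count_error R n.+1 H d m; rewrite d0 dH nm => /(_ isT erefl).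
  rewrite -nm dens nm card_det_dvd_split -/A.
  have := card_box_singular_le R nm H0; set Z := #|_| => Zle; rewrite natrD => Tle.
  have {Tle}Ale : `|A%:R - (2 * H)%:R ^+ m.+1 * rho| <=
     m.+1%:R * (3 * H)%:R ^+ m * d%:R * rho + Z%:R.
    move: Tle; rewrite !ler_norml; have : 0 <= Z%:R :> R by [].
    move: (_ * rho) (_ * rho) => x y; lra.
  apply: le_trans (ler_wpM2r (_ : 0 <= d%:R^-1) Ale) _; first by rewrite invr_ge0.
  apply: ler_wpDl; first by rewrite divr_ge0.
  have -> : (m.+1%:R * (3 * H)%:R ^+ m * d%:R * rho + Z%:R) / d%:R =
     (3 * H)%:R ^+ m * (m.+1%:R * rho) + Z%:R * d%:R^-1.
    by field; rewrite gt_eqF.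
  have -> : P * C1 * rH ^+ 2 * w =
     P * (m.+1%:R * (K * rH ^+ 2 * w)) + n.+1%:R * P * (rH ^+ 2 * w).
    by rewrite /C1; ring.
  apply: lerD; apply: ler_pM.
  + by rewrite exprn_ge0.
  + by rewrite mulr_ge0.
  + exact: Ple.
  + rewrite ler_wpM2l //; apply: le_trans drho _.
    by rewrite ler_wpM2r ?(ltW w0) // ler_wpM2l.
  + by [].
  + by rewrite invr_ge0.
  + apply: le_trans Zle _; rewrite ler_wpM2l //; exact: Ple.
  + by rewrite dw ler_wpM2r ?(ltW w0).
(* For [d > H] nothing cancels: [A / d <= A / H], and [d ^ (2/s) / d <= H ^ (2/s) / H] saves one
   power of [H] in the main term. *)
- have anti := nroot_sqr_div_anti s1 Hp (_ : H%:R <= d%:R).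
  have {anti}anti : rd ^+ 2 / d%:R <= rH ^+ 2 / H%:R.
    by apply: anti; rewrite ler_nat ltnW.
  set c := (2 * H)%:R ^+ m.+1 * rho.
  have c0 : 0 <= c by rewrite mulr_ge0 ?exprn_ge0.
  apply: (@le_trans _ _ ((A%:R + c) / d%:R)).
    rewrite ler_wpM2r ?invr_ge0 // ler_norml; apply/andP; split; lra.
  rewrite mulrDl; apply: lerD.
    by rewrite ler_wpM2l // lef_pV2 ?posrE // ler_nat ltnW.
  apply: (@le_trans _ _ ((2 * H)%:R ^+ m.+1 * (K * (rH ^+ 2 / H%:R) * w))).
    rewrite /c -mulrA ler_wpM2l ?exprn_ge0 //.
    apply: (@le_trans _ _ (K * rd ^+ 2 * w / d%:R)).
      by rewrite ler_wpM2r ?invr_ge0.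
    have -> : K * rd ^+ 2 * w / d%:R = K * (rd ^+ 2 / d%:R) * w by ring.
    by rewrite ler_wpM2r ?(ltW w0) // ler_wpM2l.
  have -> : (2 * H)%:R ^+ m.+1 * (K * (rH ^+ 2 / H%:R) * w) =
     2 ^+ m.+1 * H%:R ^+ m * K * rH ^+ 2 * w :> R.
    by rewrite natrM exprMn !(exprSr H%:R); field; rewrite gt_eqF.
  rewrite ler_wpM2r ?(ltW w0) // ler_wpM2r ?exprn_ge0 ?nroot_ge0 //.
  apply: ler_pM; [by rewrite mulr_ge0 ?exprn_ge0|by []| |].
    by rewrite /P ler_wpM2r ?exprn_ge0 // lerXn2r ?nnegrE ?ler_nat.
  have m1 : 1 <= m.+1%:R :> R by rewrite ler1n.
  have n1 : 0 <= n.+1%:R :> R by [].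
  by rewrite /C1; nra.
Qed.

(** * Summation over all sets of primes *)

Lemma abs_det_box_le n H (B : 'M['I_(2 * H).+1]_n) :
  (`|\det (shift_mx H B)| <= n`! * H ^ n)%N.
Proof.
rewrite -lez_nat abszE; apply: abs_det_leq => i j; rewrite !mxE.
by have := ltn_ord (B i j); move: (nat_of_ord _) => b; lia.
Qed.

(** Every determinant in the box is smaller than [N] in absolute value, so the totient expansion
    applies to each matrix and the two finite sums can be exchanged. *)
Lemma Phi_sum_set_prod (R : realType) n H N : (n`! * H ^ n < N)%N ->
  Phi R n H = \sum_(S : {set 'I_N} | prime_set S)
    (-1) ^+ #|S| * (#|nonsing_dvd_set n H (set_prod S)|%:R / (set_prod S)%:R).
Proof.
move=> HN; rewrite /Phi.
rewrite (eq_bigr (fun B => \sum_(S : {set 'I_N} | prime_set S) (-1) ^+ #|S| *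
    ((set_prod S %| `|\det (shift_mx H B)|)%N%:R / (set_prod S)%:R))); last first.
  move=> B nz; rewrite -totient_div_sum // absz_gt0 nz /=.
  exact: leq_ltn_trans (abs_det_box_le B) HN.
rewrite exchange_big /=; apply: eq_bigr => S _.
rewrite -mulr_sumr -mulr_suml; congr (_ * (_ / _)).
rewrite -natr_sum; congr _%:R; rewrite -sum1_card.
rewrite [RHS]big_mkcond [LHS]big_mkcond /=; apply: eq_bigr => B _.
by rewrite inE dvdzE /=; case: ifP => //= _; case: ifP.
Qed.

(** Double counting: a nonsingular matrix is counted once for each [S] whose product divides its
    determinant, and the divisor bound applies to a determinant of size at most [n! * H ^ n]. *)
Lemma sum_card_nonsing_le (R : realType) n H N s : (0 < s)%N -> (0 < H)%N ->
  \sum_(S : {set 'I_N} | prime_set S) #|nonsing_dvd_set n H (set_prod S)|%:R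
  <= (3 * H)%:R ^+ (n * n) *
     (nroot s ((2 ^ s) ^ (2 ^ s) * n`!)%:R * nroot s H%:R ^+ n) :> R.
Proof.
move=> s0 H0; pose T (B : 'M['I_(2 * H).+1]_n) :=
  [set S : {set 'I_N} | prime_set S && (set_prod S %| `|\det (shift_mx H B)|)%N].
have -> : \sum_(S : {set 'I_N} | prime_set S) #|nonsing_dvd_set n H (set_prod S)|%:R =
    \sum_(B | \det (shift_mx H B) != 0) #|T B|%:R :> R.
  rewrite -!natr_sum; congr _%:R.
  under eq_bigr => S _ do rewrite -sum1_card big_mkcond /=.
  under [RHS]eq_bigr => B _ do rewrite -sum1_card big_mkcond /=.
  rewrite exchange_big /= [RHS]big_mkcond /=; apply: eq_bigr => B _.
  rewrite big_mkcond /=; case: ifP => nz.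
    by apply: eq_bigr => S _; rewrite !inE nz dvdzE /=; case: ifP.
  by rewrite big1 // => S _; rewrite !inE nz /=; case: ifP.
set c := nroot s _ * _.
have c0 : 0 <= c by rewrite mulr_ge0 ?exprn_ge0 ?nroot_ge0.
apply: (@le_trans _ _ (\sum_(B : 'M['I_(2 * H).+1]_n) c)).
  rewrite big_mkcond /=; apply: ler_sum => B _; case: ifP => // nz.
  rewrite /c -nroot_exp // -nrootM ?exprn_ge0 //; apply: le_nroot => //.
  rewrite -!natrX -natrM ler_nat.
  apply: leq_trans (card_set_prod_dvd _ _ _) _; first by rewrite absz_gt0 nz.
  by rewrite -mulnA leq_mul2l abs_det_box_le orbT.
rewrite sumr_const card_mx card_ord -[leLHS]mulr_natl natrX ler_wpM2r //.
by rewrite lerXn2r ?nnegrE // ler_nat; lia.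
Qed.

(** The divisor term brings [nroot s H] to the power [n.+1] and the weighted term to the power 2;
    the common exponent [n.+3] covers both. *)
Lemma Phi_partial_product_error (R : realType) n H m N s :
  (n.+1 * n.+1 = m.+1)%N -> (0 < H)%N -> (1 < s)%N -> (n.+1`! * H ^ n.+1 < N)%N ->
  `|Phi R n.+1 H - (2 * H)%:R ^+ m.+1 * \prod_(p < N | prime p) sigma_factor R n.+1 p|
  <= (3 ^+ m.+1 * nroot s ((2 ^ s) ^ (2 ^ s) * n.+1`!)%:R +
      6 ^+ m.+1 * (m.+1%:R * nroot s ((n.+1 ^ s) ^ (n.+1 ^ s))%:R + n.+1%:R) * (1 + s%:R))
     * (H%:R ^+ m * nroot s H%:R ^+ n.+3).
Proof.
move=> nm H0 s1 HN; have s0 : (0 < s)%N by apply: ltnW.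
set K := nroot s (((_ ^ _) ^ (_ ^ _))%N)%:R; set K2 := nroot s _%:R.
have Hp : 0 < H%:R :> R by rewrite ltr0n.
set rH := nroot s H%:R.
have rH1 : 1 <= rH by rewrite nroot_ge1 // ler1n.
under eq_bigr => p _ do rewrite sigma_factorE //.
rewrite (prod_prime_distr (fun p => local_density R n.+1 p / p%:R)).
rewrite (Phi_sum_set_prod R HN) mulr_sumr -sumrB.
apply: le_trans (ler_norm_sum _ _ _) _.
pose w d : R := (d%:R * nroot s d%:R)^-1.
pose C1 : R := 6 ^+ m.+1 * (m.+1%:R * K + n.+1%:R).
have C10 : 0 <= C1.
  by rewrite mulr_ge0 ?exprn_ge0 // addr_ge0 // mulr_ge0 ?nroot_ge0.
apply: (@le_trans _ _ (\sum_(S : {set 'I_N} | prime_set S)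
   (#|nonsing_dvd_set n.+1 H (set_prod S)|%:R / H%:R +
    C1 * H%:R ^+ m * rH ^+ 2 * w (set_prod S)))).
  apply: ler_sum => S pS.
  apply: le_trans (set_error nm H0 s1 pS (nroot_ge0 _ _)
    (exp_card_le_nroot R s0 (ltn0Sn n) pS)).
  rewrite prodf_div -natr_prod -/(set_prod S) [X in _ - X]mulrCA -mulrBr normrM normrX normrN1.
  by rewrite expr1n mul1r mulrA -mulrBl normrM (ger0_norm (_ : 0 <= (set_prod S)%:R^-1)) ?invr_ge0.
rewrite big_split /= -mulr_suml -mulr_sumr [leRHS]mulrDl; apply: lerD.
  apply: (@le_trans _ _ ((3 * H)%:R ^+ m.+1 * (K2 * rH ^+ n.+1) / H%:R)).
    by rewrite ler_wpM2r ?invr_ge0 // -nm sum_card_nonsing_le.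
  have -> : (3 * H)%:R ^+ m.+1 * (K2 * rH ^+ n.+1) / H%:R =
      3 ^+ m.+1 * K2 * (H%:R ^+ m * rH ^+ n.+1).
    by rewrite natrM exprMn !(exprSr H%:R); field; rewrite gt_eqF.
  rewrite ler_wpM2l ?mulr_ge0 ?exprn_ge0 ?nroot_ge0 // ler_wpM2l ?exprn_ge0 //.
  by apply: ler_weXn2l; [exact: rH1|lia].
rewrite -/C1 -[leLHS]mulrA.
have -> : C1 * (1 + s%:R) * (H%:R ^+ m * rH ^+ n.+3) =
    C1 * H%:R ^+ m * (rH ^+ n.+3 * (1 + s%:R)) by ring.
apply: ler_wpM2l; first by apply: mulr_ge0 => //; apply: exprn_ge0.
apply: ler_pM.
- by rewrite exprn_ge0 ?nroot_ge0.
- by apply: sumr_ge0 => S _; rewrite invr_ge0 mulr_ge0 ?nroot_ge0.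
- by apply: ler_weXn2l; [exact: rH1|lia].
- apply: sum_set_prod_le => [d|M]; first by rewrite invr_ge0 mulr_ge0 ?nroot_ge0.
  exact: sum_inv_nroot_le.
Qed.

(** * Passage to the infinite Euler product *)

Lemma sigma_factor_itv (R : realType) n p : (0 < n)%N -> prime p ->
  0 <= sigma_factor R n p <= 1.
Proof.
move=> n0 pp; rewrite sigma_factorE //.
have [/andP[l0 _] l1] := local_density_bound R n (prime_gt0 pp).
have p1 : 1 <= p%:R :> R by rewrite ler1n prime_gt0.
have pp0 : 0 < p%:R :> R by rewrite ltr0n prime_gt0.
rewrite subr_ge0 ler_pdivrMr // mul1r (le_trans l1 p1) gerBl.
by rewrite divr_ge0 // ltW.
Qed.

Local Open Scope classical_set_scope.

(** The factors lie in [[0, 1]], so the partial products decrease and are bounded below; hence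
    [sigma] is a genuine limit and not a default value of [limn]. *)
Lemma cvg_sigma (R : realType) n : (0 < n)%N ->
  (fun N : nat => (\prod_(p < N | prime p) sigma_factor R n p : R)) @ \oo --> sigma R n.
Proof.
move=> n0; set u := (X in X @ _ --> _).
have uS N : u N.+1 = u N * (if prime N then sigma_factor R n N else 1).
  by rewrite /u [LHS]big_mkcond big_ord_recr /= -big_mkcond.
have f01 N : 0 <= (if prime N then sigma_factor R n N else 1) <= 1.
  by case: ifP => pN; [exact: sigma_factor_itv|rewrite ler01 lexx].
have u0 N : 0 <= u N.
  elim: N => [|N IH]; first by rewrite /u big_ord0.
  by rewrite uS mulr_ge0 //; case/andP: (f01 N).
apply: nonincreasing_is_cvgn.
  apply/nonincreasing_seqP => N; rewrite uS ler_piMr //.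
  by case/andP: (f01 N).
by exists 0 => _ [N _ <-].
Qed.

(** The bound for partial products is the same for all large [N], so it survives the limit. *)
Lemma Phi_sigma_error (R : realType) n H m s :
  (n.+1 * n.+1 = m.+1)%N -> (0 < H)%N -> (1 < s)%N ->
  `|Phi R n.+1 H - (2 * H)%:R ^+ m.+1 * sigma R n.+1|
  <= (3 ^+ m.+1 * nroot s ((2 ^ s) ^ (2 ^ s) * n.+1`!)%:R +
      6 ^+ m.+1 * (m.+1%:R * nroot s ((n.+1 ^ s) ^ (n.+1 ^ s))%:R + n.+1%:R) * (1 + s%:R))
     * (H%:R ^+ m * nroot s H%:R ^+ n.+3).
Proof.
move=> nm H0 s1; set E := (X in _ <= X).
pose u N : R := `|Phi R n.+1 H - (2 * H)%:R ^+ m.+1 *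
  \prod_(p < N | prime p) sigma_factor R n.+1 p|.
have cu : u @ \oo --> `|Phi R n.+1 H - (2 * H)%:R ^+ m.+1 * sigma R n.+1|.
  apply: cvg_norm; apply: cvgB; first exact: cvg_cst.
  by apply: cvgMr; exact: cvg_sigma.
rewrite -(cvg_lim _ cu) //; apply: limr_le; first by apply/cvg_ex; eexists; exact: cu.
near=> N; apply: Phi_partial_product_error => //.
near: N; exact: nbhs_infty_gt.
Unshelve. all: by end_near.
Qed.

Local Close Scope classical_set_scope.

Theorem theorem1p3 (R : realType) (n : nat) (hn : (1 <= n)%N) :
  forall eps : R, 0 < eps ->
  exists C : R, exists H0 : nat, forall H : nat, (H0 <= H)%N ->
    `| Phi R n H - (2 ^ (n * n))%:R * sigma R n * (H%:R) ^+ (n * n) |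
      <= C * (H%:R) `^ ((n * n)%:R - theta R n + eps).
Proof.
case: n hn => // n _ eps eps0.
pose m := (n.+1 * n.+1).-1; have nm : (n.+1 * n.+1 = m.+1)%N by [].
(* The exponent [(n + 2) / s] of [nroot s H ^+ (n + 2)] is then [1 / (n^3 + 1)]. *)
pose s := (n.+3 * (n.+1 ^ 3).+1)%N.
have s1 : (1 < s)%N by rewrite /s; lia.
set E := (3 ^+ m.+1 * nroot s ((2 ^ s) ^ (2 ^ s) * n.+1`!)%:R +
      6 ^+ m.+1 * (m.+1%:R * nroot s ((n.+1 ^ s) ^ (n.+1 ^ s))%:R + n.+1%:R) * (1 + s%:R)) : R.
exists E, 1%N => H H0.
have Hp : 0 < H%:R :> R by rewrite ltr0n.
have E0 : 0 <= E.
  rewrite addr_ge0 ?mulr_ge0 ?exprn_ge0 ?nroot_ge0 //.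
  by rewrite addr_ge0 ?mulr_ge0 ?nroot_ge0.
have -> : (2 ^ (n.+1 * n.+1))%:R * sigma R n.+1 * H%:R ^+ (n.+1 * n.+1) =
    (2 * H)%:R ^+ m.+1 * sigma R n.+1.
  by rewrite nm natrM exprMn natrX mulrAC.
apply: le_trans (Phi_sigma_error R nm H0 s1) _; rewrite ler_wpM2l //.
rewrite /nroot -!powR_mulrn ?powR_ge0 ?ler0n // -powRrM -powRD; last first.
  by rewrite (gt_eqF Hp) implybT.
(* It remains to compare exponents: the left one is [m + 1 / (n.+1 ^ 3 + 1)], which is
   [m.+1 - theta R n.+1], and the right one exceeds it by [eps]. *)
apply: ler_powR; first by rewrite ler1n.
rewrite nm /theta -(natr1 m) /s natrM invfM mulrAC mulVf ?pnatr_eq0 // mul1r.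
by move: (_%:R^-1) => x; lra.
Qed.
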